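(* Let $\omega:[0,1]\to\mathbb{R}$ be a continuous nonconstant function, with associated tree $(\mathbb{T},\delta)$, projection $\pi$, length measure $\lambda$, distinguished points $O,A,B$, and measures $\omega^\nearrow$, $\omega^\nwarrow$ on $[0,1]$ (all defined in the context). (i) Assume $\omega(0)=\omega(1)=\inf_{[0,1]}\omega$. Then the measures $\omega^\nearrow$ and $\omega^\nwarrow$ are $\sigma$-finite and are respectively the images of $\lambda$ by the maps $\tau\mapsto\tau^\nearrow$ and $\tau\mapsto\tau^\nwarrow$ from $\mathbb{T}$ to $[0,1]$; moreover $\lambda$ is the image of $\omega^\nearrow$, and also the image of $\omega^\nwarrow$, by the projection $\pi$. (ii) If the condition $\omega(0)=\omega(1)=\inf_{[0,1]}\omega$ does not hold, then, considering $\tau\mapsto\tau^\nearrow$ on $\mathbb{T}\setminus[O,A]$ and $\tau\mapsto\tau^\nwarrow$ on $\mathbb{T}\setminus[O,B]$, the same relations hold after restricting $\lambda$: $\omega^\nearrow$ is $\sigma$-finite and is the image of $\lambda|_{\mathbb{T}\setminus[O,A]}$ by $\tau\mapsto\tau^\nearrow$, and $\lambda|_{\mathbb{T}\setminus[O,A]}$ is the image of $\omega^\nearrow$ by $\pi$; likewise $\omega^\nwarrow$ is $\sigma$-finite and is the image of $\lambda|_{\mathbb{T}\setminus[O,B]}$ by $\tau\mapsto\tau^\nwarrow$, and $\lambda|_{\mathbb{T}\setminus[O,B]}$ is the image of $\omega^\nwarrow$ by $\pi$.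
   Context: For a continuous nonconstant $\omega:[0,1]\to\mathbb{R}$, put $\delta(s,t)=\omega(s)+\omega(t)-2\inf_{[s,t]}\omega$ ($[s,t]$ denotes the interval with endpoints $s,t$). This is a semi-distance on $[0,1]$; the quotient metric space $\mathbb{T}=([0,1]/\delta,\delta)$ is a compact real tree, i.e. any two points $\tau_1,\tau_2$ are joined by a unique arc $[\tau_1,\tau_2]$, which is isometric to $[0,\delta(\tau_1,\tau_2)]$. Let $\pi:[0,1]\to\mathbb{T}$ be the (continuous) projection. Let $O=\pi(U)$, where $U$ is a time at which $\omega$ attains its minimum, $A=\pi(0)$, $B=\pi(1)$; $O$ is the root of $\mathbb{T}$ (when $\omega(0)=\omega(1)=\inf\omega$, $O=A=B$). A point $\tau_1$ is above $\tau_2$ if $\tau_2\in[O,\tau_1]$. A leaf is a point with no other point above it; the skeleton $S(\mathbb{T})$ is the set of points which are not leaves. The length measure $\lambda$ is the unique measure on $\mathbb{T}$ for which the set of leaves has measure zero and the measure of each arc is its length ($\lambda$ is $\sigma$-finite and atomless). Put $\tau^\nearrow=\inf\pi^{-1}(\tau)$ and $\tau^\nwarrow=\sup\pi^{-1}(\tau)$. $E^\nearrow$ (beginnings of excursions) is the set of $t\in[0,1)$ such that for some $\varepsilon>0$, $\omega(s)>\omega(t)$ for $t<s<t+\varepsilon$; $E^\nwarrow$ (ends of excursions) is the set of $t\in(0,1]$ such that for some $\varepsilon>0$, $\omega(s)>\omega(t)$ for $t-\varepsilon<s<t$. For each level $x$ the sets $\{s\in E^\nearrow:\omega(s)=x\}$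 and $\{s\in E^\nwarrow:\omega(s)=x\}$ are at most countable, and one defines measures on $[0,1]$ by $$\omega^\nearrow=\int_{\mathbb{R}}\sum_{s\in E^\nearrow,\ \omega(s)=x}\delta_s\,dx,\qquad \omega^\nwarrow=\int_{\mathbb{R}}\sum_{s\in E^\nwarrow,\ \omega(s)=x}\delta_s\,dx,$$ where $\delta_s$ is the Dirac mass at $s$. *)

(* Defs.v *)
From HB Require Import structures.
From mathcomp Require Import all_boot all_order all_algebra generic_quotient.
From mathcomp Require Import all_classical all_reals all_analysis.
From mathcomp Require Import lra.

Set Implicit Arguments.
Unset Strict Implicit.
Unset Printing Implicit Defensive.

Import Order.TTheory GRing.Theory Num.Theory.
Import numFieldNormedType.Exports.

Local Open Scope classical_set_scope.
Local Open Scope ring_scope.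
Local Open Scope quotient_scope.

Definition time (R : realType) : Type := set_type (`[0, 1]%classic : set R).

HB.instance Definition _ (R : realType) :=
  Topological.copy (time R) (set_type (`[0, 1]%classic : set R)).

Definition time_val (R : realType) (t : time R) : R := set_val t.
Coercion time_val : time >-> Real.sort.

Lemma zero_time (R : realType) : (0 : R) \in (`[0, 1]%classic : set R).
Proof. by rewrite inE /= in_itv /= lexx ler01. Qed.

Lemma one_time (R : realType) : (1 : R) \in (`[0, 1]%classic : set R).
Proof. by rewrite inE /= in_itv /= ler01 lexx. Qed.

Definition time0 (R : realType) : time R := SigSub (zero_time R).
Definition time1 (R : realType) : time R := SigSub (one_time R).

HB.instance Definition _ (R : realType) := isPointed.Build (time R) (time0 R).

Definition time_between (R : realType) (s t : time R) : set (time R) :=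
  [set u : time R |
    Num.min (s : R) (t : R) <= (u : R) <= Num.max (s : R) (t : R)].

Definition semidist (R : realType) (w : continuousType (time R) R)
    (s t : time R) : R :=
  w s + w t - 2 * inf (w @` time_between s t).

Section semidist_theory.
Context (R : realType) (w : continuousType (time R) R).
Implicit Types s t u : time R.

Lemma time_itv t : 0 <= (t : R) <= 1.
Proof.
have : (`[0, 1]%classic : set R) (t : R) by exact: set_valP.
by rewrite /= in_itv.
Qed.

Lemma path_lbound : exists m, forall t, m <= w t.
Proof.
have cw : {within (`[0, 1]%classic : set R), continuous (valL_ (0 : R) w)}.
  by apply/subspace_valL_continuousP'; exact: cts_fun.
have [c _ mc] := @EVT_min R _ 0 1 ler01 cw.
exists (valL_ (0 : R) w c) => t.
have := mc (t : R).
rewrite in_itv /= => /(_ (time_itv t)).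
by have /(congr1 (@^~ t)) <- := @valLK _ _ (0 : R) (`[0, 1]%classic : set R) w.
Qed.

Lemma between_sym s t : time_between s t = time_between t s.
Proof. by rewrite /time_between minC maxC. Qed.

Lemma between_l s t : time_between s t s.
Proof. by rewrite /time_between /= ge_min le_max lexx. Qed.

Lemma inf_le s t u : time_between s t u -> inf (w @` time_between s t) <= w u.
Proof.
move=> stu; apply: ge_inf; last by exists u.
by have [m mw] := path_lbound; exists m => _ [v _ <-].
Qed.

Lemma le_inf_between s t (m : R) :
  (forall u, time_between s t u -> m <= w u) -> m <= inf (w @` time_between s t).
Proof.
move=> h; apply: lb_le_inf; first by exists (w s), s => //; exact: between_l.
by move=> _ [v stv <-]; exact: h.
Qed.

Lemma semidist_sym s t : semidist w s t = semidist w t s.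
Proof. by rewrite /semidist between_sym (addrC (w s)). Qed.

Lemma semidistxx s : semidist w s s = 0.
Proof.
rewrite /semidist; suff -> : inf (w @` time_between s s) = w s.
  by rewrite mulr_natl mulr2n subrr.
apply/eqP; rewrite eq_le inf_le /=; last exact: between_l.
apply: le_inf_between => u; rewrite /time_between /= minxx maxxx => /andP[su us].
suff -> : u = s by [].
by apply/val_inj/eqP; rewrite eq_le; apply/andP; split.
Qed.

Lemma semidist_ge0 s t : 0 <= semidist w s t.
Proof.
rewrite /semidist mulr_natl mulr2n opprD addrACA addr_ge0// subr_ge0.
  by apply: inf_le; exact: between_l.
by rewrite between_sym; apply: inf_le; exact: between_l.
Qed.

Lemma semidist_triangle t s u :
  semidist w s u <= semidist w s t + semidist w t u.
Proof.
rewrite /semidist.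
set a := inf _; set b := inf _; set c := inf _.
have bt : b <= w t by rewrite /b between_sym; apply: inf_le; exact: between_l.
have ct : c <= w t by apply: inf_le; exact: between_l.
have abc : Num.min b c <= a.
  apply: le_inf_between => v; rewrite /time_between /= => sv.
  have [stv|tuv] : time_between s t v \/ time_between t u v.
    move: sv; rewrite /time_between /= !ge_min !le_max.
    case: (lerP (v : R) (t : R)) => [vt|/ltW tv].
      by case/andP=> /orP[] sv _; [left|right]; rewrite ?sv ?vt ?orbT.
    by case/andP=> _ /orP[] sv; [left|right]; rewrite ?sv ?tv ?orbT.
  - by rewrite ge_min; apply/orP; left; exact: inf_le.
  - by rewrite ge_min; apply/orP; right; exact: inf_le.
have : b + c - w t <= a.
  by apply: le_trans abc; rewrite le_min; apply/andP; split; lra.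
lra.
Qed.

Definition same_point : rel (time R) := [rel s t | semidist w s t == 0].

Lemma same_point_equiv : equiv_class_of same_point.
Proof.
split=> [s|s t|t s u]; rewrite /same_point /=; first by rewrite semidistxx.
  by rewrite semidist_sym.
move=> /eqP st /eqP tu; rewrite eq_le semidist_ge0 andbT.
by rewrite (le_trans (semidist_triangle t s u))// st tu addr0.
Qed.

Canonical same_point_equivRel := EquivRelPack same_point_equiv.

End semidist_theory.

Definition tree (R : realType) (w : continuousType (time R) R) : Type :=
  {eq_quot same_point w}.

HB.instance Definition _ (R : realType) (w : continuousType (time R) R) :=
  Choice.on (tree w).
HB.instance Definition _ (R : realType) (w : continuousType (time R) R) :=
  Quotient.on (tree w).

Definition tree_proj (R : realType) (w : continuousType (time R) R)
  (t : time R) : tree w := \pi_(tree w) t.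

Definition tree_dist (R : realType) (w : continuousType (time R) R)
  (a b : tree w) : R := semidist w (repr a) (repr b).

Section tree_metric.
Context (R : realType) (w : continuousType (time R) R).
Implicit Types (s t : time R) (a b c : tree w).

Lemma proj_eq s t : tree_proj w s = tree_proj w t <-> semidist w s t = 0.
Proof.
split=> [/eqquotP/eqP //|st0]; apply/eqquotP; exact/eqP.
Qed.

Lemma proj_repr a : tree_proj w (repr a) = a.
Proof. exact: reprK. Qed.

Lemma tree_dist_proj s t : tree_dist (tree_proj w s) (tree_proj w t) = semidist w s t.
Proof.
have sE u : semidist w u (repr (tree_proj w u)) = 0.
  by apply/proj_eq; rewrite proj_repr.
rewrite /tree_dist; apply/eqP; rewrite eq_le; apply/andP; split.
  rewrite (le_trans (semidist_triangle w s _ _))// semidist_sym sE add0r.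
  by rewrite (le_trans (semidist_triangle w t _ _))// sE addr0.
rewrite (le_trans (semidist_triangle w (repr (tree_proj w s)) _ _))// sE add0r.
rewrite (le_trans (semidist_triangle w (repr (tree_proj w t)) _ _))//.
by rewrite (semidist_sym w _ t) sE addr0.
Qed.

Lemma tree_distxx a : tree_dist a a = 0.
Proof. exact: semidistxx. Qed.

Lemma tree_dist_positivity a b : tree_dist a b = 0 -> a = b.
Proof. by move/proj_eq; rewrite !proj_repr. Qed.

Lemma tree_dist_sym a b : tree_dist a b = tree_dist b a.
Proof. exact: semidist_sym. Qed.

Lemma tree_dist_triangle b a c :
  tree_dist a c <= tree_dist a b + tree_dist b c.
Proof. exact: semidist_triangle. Qed.

HB.instance Definition _ := isMetric.Build R (tree w)
  tree_distxx tree_dist_positivity tree_dist_sym tree_dist_triangle.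
HB.instance Definition _ := isPointed.Build (tree w) (tree_proj w (time0 R)).

Lemma mdist_tree_proj s t :
  mdist (tree_proj w s) (tree_proj w t) = semidist w s t.
Proof. exact: tree_dist_proj. Qed.

Lemma ball_tree a (e : R) : ball a e = [set b | tree_dist a b < e].
Proof. by []. Qed.

End tree_metric.

Notation borel T := (g_sigma_algebraType (@open T)).

Section tree_geometry.
Context (R : realType) (w : continuousType (time R) R).
Implicit Types (a b : tree w) (root : tree w).

Definition is_geodesic a b (g : R -> tree w) : Prop :=
  [/\ g 0 = a, g (mdist a b) = b &
      forall x y, 0 <= x <= mdist a b -> 0 <= y <= mdist a b ->
        mdist (g x) (g y) = `|x - y|].

(* In a real tree there is exactly one geodesic image joining a and b, so the
   union below is over a single set. *)
Definition tree_arc a b : set (tree w) :=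
  [set c | exists2 g, is_geodesic a b g & (g @` `[0, mdist a b]%classic) c].

Definition tree_above root a b : Prop := tree_arc root a b.

Definition tree_leaf root : set (tree w) :=
  [set a | ~ exists b, b <> a /\ tree_above root b a].

(* The requirement determines the measure: the complement of the leaves is a
   countable union of arcs. *)
Definition is_length_measure root
    (lambda : {measure set (borel (tree w)) -> \bar R}) : Prop :=
  lambda (tree_leaf root) = 0%E /\
  forall a b, lambda (tree_arc a b) = (mdist a b)%:E.

End tree_geometry.

Section visit_times.
Context (R : realType) (w : continuousType (time R) R).

Definition visits (a : tree w) : set R :=
  [set (t : R) | t in tree_proj w @^-1` [set a]].

Lemma visits_neq0 a : visits a !=set0.
Proof. by exists (repr a : R), (repr a) => //=; exact: proj_repr. Qed.

Lemma visits01 a x : visits a x -> 0 <= x <= 1.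
Proof. by move=> [t _ <-]; exact: time_itv. Qed.

Lemma inf_visits a : inf (visits a) \in (`[0, 1]%classic : set R).
Proof.
rewrite inE /= in_itv /=; apply/andP; split.
  apply: lb_le_inf; first exact: visits_neq0.
  by move=> x /visits01/andP[].
have [x ax] := visits_neq0 a; have /andP[_ x1] := visits01 ax.
apply: le_trans x1; apply: ge_inf => //.
by exists 0 => y /visits01/andP[].
Qed.

Lemma sup_visits a : sup (visits a) \in (`[0, 1]%classic : set R).
Proof.
rewrite inE /= in_itv /=; apply/andP; split; last first.
  apply: ge_sup; first exact: visits_neq0.
  by move=> x /visits01/andP[].
have [x ax] := visits_neq0 a; have /andP[x0 _] := visits01 ax.
apply: le_trans x0 _; apply: ub_le_sup => //.
by exists 1 => y /visits01/andP[].
Qed.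

Definition first_visit (a : tree w) : time R := SigSub (inf_visits a).
Definition last_visit (a : tree w) : time R := SigSub (sup_visits a).

End visit_times.

Section excursions.
Context (R : realType) (w : continuousType (time R) R).

Definition exc_begin : set (time R) :=
  [set t : time R | (t : R) < 1 /\ exists2 e : R, 0 < e &
     forall s : time R, (t : R) < (s : R) < (t : R) + e -> w t < w s].

Definition exc_end : set (time R) :=
  [set t : time R | 0 < (t : R) /\ exists2 e : R, 0 < e &
     forall s : time R, (t : R) - e < (s : R) < (t : R) -> w t < w s].

(* A set function whose integrand, the number of points of E in A at level x,
   is a countable sum of Dirac masses when E is exc_begin or exc_end. *)
Definition level_measure (E : set (time R)) (A : set (borel (time R))) :
    \bar R :=
  (\int[lebesgue_measure]_(x in [set: R])
    \esum_(s in E `&` [set s | w s = x]) dirac (s : borel (time R)) A)%E.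

Definition begin_measure := level_measure exc_begin.
Definition end_measure := level_measure exc_end.

End excursions.

Definition restrict_measure d (T : measurableType d) (R : realType)
  (mu : set T -> \bar R) (D : set T) : set T -> \bar R :=
  fun A => mu (A `&` D).

(* [nu] is the image by [f : D -> U] of the restriction of [mu] to [D]. *)
Definition is_image d d' (T : measurableType d) (U : measurableType d')
    (R : realType) (mu : set T -> \bar R) (nu : set U -> \bar R)
    (D : set T) (f : T -> U) : Prop :=
  [/\ measurable D, measurable_fun D f &
      forall A, measurable A -> nu A = restrict_measure mu D (f @^-1` A)].

(* Main.v *)
Require Import Defs.
From HB Require Import structures.
From mathcomp Require Import all_boot all_order all_algebra.
From mathcomp Require Import all_classical all_reals all_analysis.
From mathcomp Require Import measurable_realfun lra.

(* Call [c] an ancestor of [a] when [w >= w c] between visits to [c] and to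
   [a]; these points form the arc from the root to [a], on which the height
   [w] is an isometry onto an interval.  On each such arc the length measure is
   therefore Lebesgue measure in the height, and the skeleton is a countable
   union of such arcs (those ending at rational times), so [lambda] is the
   integral over levels [x] of the counting measure of the skeleton points at
   height [x].
   The only obstruction to matching a skeleton point with the beginning of the
   excursion above it, and the first visit to that point with this beginning,
   is a local minimum of [w]; local minimum values are countably many.  So for
   almost every level the first visit is a bijection from the skeleton points
   off [O, A] onto the beginnings of excursions.  Points of [O, A] are lost
   because their excursion towards [A] has already started at time 0.  Ends of
   excursions follow by reversing time. *)

Set Implicit Arguments.
Unset Strict Implicit.
Unset Printing Implicit Defensive.

Import Order.TTheory GRing.Theory Num.Theory.
Import numFieldNormedType.Exports.

Local Open Scope classical_set_scope.
Local Open Scope ring_scope.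

(** * Excursions of a continuous real function *)

Section real_paths.
Context (R : realType).
Implicit Types (f : R -> R) (s t u v a c x : R).

(** The times of [[u, v]] where [f <= x] form a compact set, and [r] is its maximum; by the
    intermediate value theorem, [f r < x] would produce a later one. *)
Lemma last_passage f u v x : continuous f -> u <= v -> f u <= x -> x < f v ->
  exists r, [/\ u <= r, r < v, f r = x & forall s, r < s -> s <= v -> x < f s].
Proof.
move=> cf uv fu fv.
pose S := `[u, v]%classic `&` (f @^-1` `]-oo, x]%classic).
have Su : S u by split; rewrite /= in_itv /= ?lexx ?uv.
have supS : has_sup S.
  by split; [exists u|exists v => y [/=]; rewrite in_itv /= => /andP[]].
have clS : closed S.
  apply: closedI; first exact: interval_closed.
  by apply: closed_comp => // y _; exact: cf.
have Sr : S (sup S).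
  by rewrite [X in X _](closure_id S).1//; exact: closure_sup supS.1 supS.2.
move: (Sr) => -[/=]; rewrite !in_itv /= => /andP[ur rv] fr.
have rlv : sup S < v.
  by rewrite lt_neqAle rv andbT; apply: contraTneq fr => ->; rewrite -ltNge.
have above s : sup S < s -> s <= v -> x < f s.
  move=> rs sv; rewrite ltNge; apply/negP => fs.
  suff : s <= sup S by rewrite leNgt rs.
  apply: sup_upper_bound => //; split; rewrite /= in_itv //=.
  by rewrite sv (le_trans ur)// ltW.
exists (sup S); split => //; apply/eqP; rewrite eq_le fr /= leNgt.
apply/negP => frx.
have /(@IVT R f _ _ x rv) : {within `[sup S, v], continuous f}.
  by apply: continuous_subspaceT => y; exact: cf.
case=> [|c].
  by rewrite minElt maxElt (lt_trans frx fv) !ltW.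
rewrite in_itv /= => /andP[rc cv] fc; move: rc; rewrite le_eqVlt => /orP[/eqP rc|rc].
  by move: frx; rewrite rc fc ltxx.
by have := above _ rc cv; rewrite fc ltxx.
Qed.

Definition below f c a : Prop :=
  forall u, (c <= u <= a) \/ (a <= u <= c) -> f c <= f u.

Lemma belowxx f c : below f c c.
Proof. by move=> u; rewrite andbC -eq_le => -[] /eqP ->. Qed.

Lemma below_trans f b c a : below f c b -> below f b a -> below f c a.
Proof.
move=> cb ba u cua.
have [ub|ub] : ((c <= u <= b) \/ (b <= u <= c)) \/
    ((b <= u <= a) \/ (a <= u <= b)) by lra.
  exact: cb.
by apply: le_trans (ba u ub); apply: cb; lra.
Qed.

(** Ancestors of one point form a chain: the times between [c] and [c'] are covered by those from
    [c] to [a] and those from [c'] to [a]. *)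
Lemma below_comparable f c c' a :
  below f c a -> below f c' a -> f c <= f c' -> below f c c'.
Proof.
move=> ca c'a cc' u ucc'.
have [ub|ub] : ((c <= u <= a) \/ (a <= u <= c)) \/
    ((c' <= u <= a) \/ (a <= u <= c')) by lra.
  exact: ca.
exact: le_trans (c'a u ub).
Qed.

Lemma exists_below f u t x : continuous f -> f u <= x -> x <= f t ->
  exists r, [/\ (u <= r <= t) \/ (t <= r <= u), below f r t & f r = x].
Proof.
move=> cf fu; rewrite le_eqVlt => /orP[/eqP ->|ft].
  by exists t; split => //; [lra|exact: belowxx].
have [ut|tu] := leP u t.
  have [r [ur rt fr fr']] := last_passage cf ut fu ft.
  exists r; split => //; first lra.
  move=> y rty; have [->|yr] := eqVneq y r; first by [].
  by rewrite fr; apply/ltW/fr'; lra.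
(* When [t < u], reflect time and use the last passage of [f (- y)]. *)
have cf' : continuous (fun y => f (- y)).
  by move=> y; apply: continuous_comp; [exact: opp_continuous|exact: cf].
have ntu : - u <= - t by lra.
have := @last_passage (fun y => f (- y)) _ _ x cf' ntu.
rewrite /= !opprK => /(_ fu ft)[r [ur rt fr fr']].
exists (- r); split => //; first lra.
move=> y rty; have [->|yr] := eqVneq y (- r); first by [].
by rewrite fr -(opprK y); apply/ltW/fr'; lra.
Qed.

(* Besides the local minimum values of [f] inside [0, 1], this contains the
   values at the ends. *)
Definition turning_levels f : set R :=
  range (fun o : bool + rat * rat => match o with
    | inl b => f b%:R
    | inr pq => inf (f @` `[ratr pq.1, ratr pq.2]%classic) end).

Lemma countable_turning_levels f : countable (turning_levels f).
Proof. by apply: card_le_trans (card_image_le _ _) _; exact: countableP. Qed.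

(** Between [a] and [b] there is room for a rational interval around [t], and [f t] is the infimum
    over it. *)
Lemma local_min_level f a t b : a < t -> t < b ->
  (forall s, a <= s <= b -> f t <= f s) -> turning_levels f (f t).
Proof.
move=> at' tb tmin.
have [p] := rat_in_itvoo at'; rewrite in_itv /= => /andP[ap pt].
have [q] := rat_in_itvoo tb; rewrite in_itv /= => /andP[tq qb].
exists (inr (p, q)) => //=; apply/eqP; rewrite eq_le; apply/andP; split.
  apply: ge_inf; last by exists t => //=; rewrite in_itv /= !ltW.
  exists (f t) => _ [y /= +] <-; rewrite in_itv /= => py.
  by apply: tmin; lra.
apply: lb_le_inf; first by exists (f t), t => //=; rewrite in_itv /= !ltW.
by move=> _ [y /= +] <-; rewrite in_itv /= => py; apply: tmin; lra.
Qed.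

(* [exc_begin] transported to functions on [R]. *)
Definition excursion_start f s : Prop :=
  s < 1 /\ exists2 e, 0 < e & forall y, s < y < s + e -> y <= 1 -> f s < f y.

(** If [r < s], then [f] is at least [f s] on the left by [below] and on the right by the excursion,
    so [s] would be a local minimum. *)
Lemma excursion_start_no_earlier f s r : 0 <= s -> excursion_start f s ->
  ~ turning_levels f (f s) -> 0 <= r -> below f s r -> s <= r.
Proof.
move=> s0 [s1 [e e0 se]] fs r0 sr; rewrite leNgt; apply/negP => rs; apply: fs.
(* Halving [e] keeps [b] strictly below [s + e]; the cap at 1 keeps it a time. *)
have [b [sb be b1]] : exists b, [/\ s < b, b < s + e & b <= 1].
  by exists (Num.min (s + e / 2) 1); split;
    rewrite ?lt_min ?gt_min ?ge_min ?lexx ?orbT//; lra.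
apply: (@local_min_level f r s b) => // y ryb.
have [ys|sy] := leP y s; first by apply: sr; lra.
by apply/ltW/se; lra.
Qed.

(** The case [r = 0] of the previous lemma leaves only [s = 0], and the value there was put among
    the turning levels. *)
Lemma excursion_start_not_below0 f s : 0 <= s -> excursion_start f s ->
  ~ turning_levels f (f s) -> ~ below f s 0.
Proof.
move=> s0 es fs /(excursion_start_no_earlier s0 es fs (lexx 0)) s0'.
by apply: fs; exists (inl false) => //=; congr f; lra.
Qed.

Lemma excursion_start_above f s : excursion_start f s ->
  exists v, [/\ s < v, v <= 1, f s < f v & below f s v].
Proof.
move=> [s1 [e e0 se]].
have [b [sb be b1]] : exists b, [/\ s < b, b < s + e & b <= 1].
  by exists (Num.min (s + e / 2) 1); split;
    rewrite ?lt_min ?gt_min ?ge_min ?lexx ?orbT//; lra.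
exists b; split => //; first by apply: se; lra.
move=> y sy; have [ys|sy'] := leP y s.
  by have -> : y = s by lra.
by apply/ltW/se; lra.
Qed.

(** Here [t] is the first visit to a point off the arc leading to time 0, and [v] is a visit to a
    higher descendant. The time [u] witnesses that the path is below [f t] somewhere before [t]. *)
Lemma first_excursion_start f t v : continuous f -> 0 <= t <= 1 ->
  ~ turning_levels f (f t) ->
  (forall r, 0 <= r -> below f t r -> f r = f t -> t <= r) ->
  0 <= v <= 1 -> below f t v -> f t < f v -> ~ below f t 0 ->
  excursion_start f t.
Proof.
move=> cf t01 ft tfirst v01 tv ftv /existsNP[u /not_implyP[ut0 fut]].
have {}fut : f u < f t by lra.
(* If the descendant is visited before [t], the path climbs from [f u] to [f v] through the level
   [f t], and its last passage there is an earlier visit to the same point. *)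
have [vt|tv'] := leP v t.
  have uv : u <= v.
    by rewrite leNgt; apply/negP => vu; have := tv u; lra.
  have [r [ur rv fr fr']] := last_passage cf uv (ltW fut) ftv.
  suff : t <= r by lra.
  apply: tfirst => //; first lra.
  move=> y try; have [vy|yv] := leP v y; first by apply: tv; lra.
  have [->|yr] := eqVneq y r; first by rewrite fr.
  by apply/ltW/fr'; lra.
(* If it is visited after [t], the excursion starts at the last passage at level [f t]; a last
   passage other than [t] would be a local minimum. *)
have [r [tr rv fr fr']] := last_passage cf (ltW tv') (lexx _) ftv.
have [rt|rt] := eqVneq r t.
  by split; [lra|exists (v - t); [lra|move=> y ? ?; apply: fr'; lra]].
exfalso; apply: ft; rewrite -fr.
have {}tr : t < r by lra.
apply: (@local_min_level f t r v) => // y tyv; rewrite fr.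
by apply: tv; lra.
Qed.

End real_paths.

(** * Heights and ancestors in the tree *)

Section nearest_time.
Context (R : realType).

Lemma clamp01 (x : R) : Num.min (Num.max x 0) 1 \in (`[0, 1]%classic : set R).
Proof. by rewrite inE /= in_itv /= le_min le_max ge_min !lexx !orbT ler01. Qed.

Definition nearest_time (x : R) : time R := SigSub (clamp01 x).

Lemma nearest_timeE x : 0 <= x <= 1 -> nearest_time x = x :> R.
Proof. by case/andP=> x0 x1; rewrite /time_val /= set_valE /= max_l// min_l. Qed.

Lemma nearest_timeK (t : time R) : nearest_time t = t.
Proof. by apply: val_inj; exact: nearest_timeE (time_itv t). Qed.

Lemma continuous_nearest_time : continuous nearest_time.
Proof.
apply: continuous_comp_initial => x.
apply: (@continuous_comp _ _ _ (fun x : R => Num.max x 0) (fun x => Num.min x 1)).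
  by apply: (@continuous_max R R id (cst 0)); [exact: cvg_id|exact: cvg_cst].
by apply: (@continuous_min R R id (cst 1)); [exact: cvg_id|exact: cvg_cst].
Qed.

Lemma continuous_time_val : continuous (@time_val R).
Proof. exact: initial_continuous. Qed.

End nearest_time.

Section tree_order.
Context (R : realType) (w : continuousType (time R) R).
Implicit Types (s t : time R) (a b c : tree w).

(** The path extended to the line by its end values, so that the results on continuous real
    functions apply. *)
Definition path_fun (x : R) : R := w (nearest_time x).

Lemma path_funE t : path_fun t = w t.
Proof. by rewrite /path_fun nearest_timeK. Qed.

Lemma continuous_path_fun : continuous path_fun.
Proof.
move=> x; apply: continuous_comp; first exact: continuous_nearest_time.
exact: cts_fun.
Qed.

Lemma time_betweenP s t u :
  time_between s t u <->
  (s <= u :> R) && (u <= t :> R) \/ (t <= u :> R) && (u <= s :> R).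
Proof.
rewrite /time_between /=.
by have [st|/ltW ts] := leP (s : R) (t : R);
  split => [|[]]; lra.
Qed.

Lemma height_lipschitz s t : w t - w s <= semidist w s t.
Proof.
rewrite /semidist; set i := inf _.
have : i <= w s by apply: Defs.inf_le; exact: between_l.
lra.
Qed.

(** Equality in the Lipschitz bound above means that the infimum between the two times is [w s]. *)
Lemma semidist_below s t : semidist w s t = w t - w s <-> below path_fun s t.
Proof.
rewrite /semidist; set i := inf _.
have is_ : i <= w s by apply: Defs.inf_le; exact: between_l.
split=> [e x sxt|st].
  have x01 : 0 <= x <= 1.
    by have := time_itv s; have := time_itv t; lra.
  have {1}-> : path_fun s = i by rewrite path_funE; lra.
  by apply: Defs.inf_le; apply/time_betweenP; rewrite !nearest_timeE.
suff : w s <= i by lra.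
apply: le_inf_between => u /time_betweenP stu.
by rewrite -!path_funE; apply: st.
Qed.

Definition height a : R := w (repr a).

(** The Lipschitz bound, used in both directions, shows that times at distance zero have equal
    values, so the representative chosen in [height] does not matter. *)
Lemma height_proj t : height (tree_proj w t) = w t.
Proof.
have e : semidist w (repr (tree_proj w t)) t = 0.
  by apply/proj_eq; rewrite proj_repr.
have := height_lipschitz (repr (tree_proj w t)) t.
have := height_lipschitz t (repr (tree_proj w t)).
by rewrite semidist_sym e /height; lra.
Qed.

(** A metric condition that names no root; [ancestor_proj] translates it to paths, and
    [tree_arc_root] to the arc from the root. *)
Definition ancestor c a : Prop := mdist c a = height a - height c.

Lemma ancestor_repr c a : ancestor c a <-> below path_fun (repr c) (repr a).
Proof. exact: semidist_below. Qed.

Lemma ancestor_proj s t :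
  ancestor (tree_proj w s) (tree_proj w t) <-> below path_fun s t.
Proof.
by rewrite /ancestor mdist_tree_proj !height_proj; exact: semidist_below.
Qed.

Lemma ancestor_trans b c a : ancestor c b -> ancestor b a -> ancestor c a.
Proof. by move=> /ancestor_repr cb /ancestor_repr /(below_trans cb)/ancestor_repr. Qed.

Lemma ancestorxx a : ancestor a a.
Proof. by apply/ancestor_repr; exact: belowxx. Qed.

(** By comparability, the lower of two ancestors of [a] is an ancestor of the higher one. *)
Lemma ancestor_dist c c' a : ancestor c a -> ancestor c' a ->
  mdist c c' = `|height c - height c'|.
Proof.
move=> /ancestor_repr ca /ancestor_repr c'a.
have [cc'|/ltW cc'] := leP (height c) (height c').
  rewrite ler0_norm ?subr_le0// opprB; apply/ancestor_repr.
  by apply: (below_comparable ca c'a); rewrite !path_funE.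
rewrite ger0_norm ?subr_ge0// metric_sym; apply/ancestor_repr.
by apply: (below_comparable c'a ca); rewrite !path_funE.
Qed.

Lemma ancestor_eq c c' a : ancestor c a -> ancestor c' a ->
  height c = height c' -> c = c'.
Proof.
move=> ca c'a cc'; apply: mdist_positivity.
by rewrite (ancestor_dist ca c'a) cc' subrr normr0.
Qed.

Lemma ancestor_height c a : ancestor c a -> height c <= height a.
Proof. by move=> ca; have := mdist_ge0 c a; rewrite ca subr_ge0. Qed.

Lemma ancestor_height_lt c a : ancestor c a -> c <> a -> height c < height a.
Proof.
move=> ca; apply: contra_notT; rewrite -leNgt => ac.
apply: (ancestor_eq ca (ancestorxx a)).
by apply/eqP; rewrite eq_le ac andbT; exact: ancestor_height.
Qed.

Lemma lipschitz_tree (f : tree w -> R) :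
  (forall a b, `|f a - f b| <= mdist a b) -> continuous f.
Proof.
move=> fl a; apply/(@cvgrPdist_lt _ _ _ (nbhs a) _) => e e0.
near=> b; apply: (le_lt_trans (fl a b)).
suff : ball a e b by rewrite ballEmdist.
by near: b; exact: nbhsx_ballx.
Unshelve. all: by end_near.
Qed.

Lemma continuous_height : continuous height.
Proof.
apply: lipschitz_tree => a b; rewrite ler_norml.
have := height_lipschitz (repr a) (repr b).
have := height_lipschitz (repr b) (repr a).
rewrite semidist_sym /mdist/= /tree_dist /height; lra.
Qed.

Lemma continuous_mdistl b : continuous (fun c => mdist c b).
Proof.
apply: lipschitz_tree => a c; rewrite ler_norml.
have := tree_dist_triangle a c b.
have := tree_dist_triangle c a b.
rewrite (tree_dist_sym c a) /mdist/=; lra.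
Qed.

Lemma closed_ancestors a : closed [set c | ancestor c a].
Proof.
rewrite [X in closed X](_ : _ =
  (fun c => mdist c a + height c) @^-1` [set height a]); last first.
  by apply/seteqP; split => c; rewrite /ancestor /=; lra.
apply: closed_comp; last exact: closed_eq.
move=> c _; apply: (@continuousD _ _ _ (fun c => mdist c a) height).
  exact: continuous_mdistl.
exact: continuous_height.
Qed.

Lemma closed_point a : closed [set a].
Proof. exact/accessible_closed_set1/hausdorff_accessible/metric_hausdorff. Qed.

Lemma continuous_tree_proj : continuous (tree_proj w).
Proof.
move=> t; apply/(@cvg_ballP _ _ _ (nbhs t) _) => e e0.
(* The distance is [(w s - w t) + 2 * (w t - i)], which is less than three quarters of [e] once the
   path varies by less than [e / 4] between the two times. *)
have e4 : 0 < e / 4 by rewrite divr_gt0.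
have /cvgrPdist_lt/(_ _ e4) ct := @continuous_path_fun (time_val t).
have [d /= d0 dP] := (nbhs_ballP _ _).1 ct.
have td : \forall s \near (nbhs t), ball (time_val t) d (time_val s).
  by apply: (@continuous_time_val R t); exact: nbhsx_ballx.
apply: filterS td => s ts.
rewrite ballEmdist /= mdist_tree_proj.
have near_t (u : R) : `|time_val t - u| < d ->
    path_fun (time_val t) - e / 4 < path_fun u < path_fun (time_val t) + e / 4.
  by move=> /dP /=; rewrite ltr_norml; lra.
have ts' : `|time_val t - time_val s| < d by exact: ts.
have ws := near_t _ ts'; rewrite !path_funE in ws near_t.
rewrite /semidist; set i := inf _.
suff : w t - e / 4 <= i by lra.
apply: le_inf_between => u /time_betweenP tus.
rewrite -(path_funE u); have /near_t : `|time_val t - time_val u| < d.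
  by move: ts'; rewrite !ltr_norml; lra.
by lra.
Qed.

End tree_order.

(** * Arcs from the root *)

Section root.
Context (R : realType) (w : continuousType (time R) R).
Context (U : time R) (U_min : forall s : time R, w U <= w s).
Implicit Types (s t : time R) (a b c : tree w).

Lemma root_ancestor a : ancestor (tree_proj w U) a.
Proof.
rewrite -(proj_repr a); apply/ancestor_proj => u _.
by rewrite path_funE; exact: U_min.
Qed.

Lemma root_height a : w U <= height a.
Proof. exact: U_min. Qed.

Lemma exists_ancestor a (x : R) : w U <= x -> x <= height a ->
  exists c, ancestor c a /\ height c = x.
Proof.
move=> Ux xa.
have := @exists_below R (path_fun w) U (repr a) x (@continuous_path_fun R w).
rewrite !path_funE => /(_ Ux xa)[r [rU ra fr]].
exists (tree_proj w (nearest_time r)).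
rewrite -{1}(proj_repr a) ancestor_proj height_proj -path_funE nearest_timeE//.
by have := time_itv U; have := time_itv (repr a); lra.
Qed.

(* The point at height [x] of the arc from the root to [a], with [x] clamped
   to the heights occurring on that arc. *)
Definition arc_point a (x : R) : tree w :=
  xget a [set c | ancestor c a /\
                  height c = Num.max (w U) (Num.min x (height a))].

Lemma arc_pointP a x : ancestor (arc_point a x) a /\
  height (arc_point a x) = Num.max (w U) (Num.min x (height a)).
Proof.
rewrite /arc_point; case: xgetP => [c -> //|noc].
have [||c] := @exists_ancestor a (Num.max (w U) (Num.min x (height a))).
- by rewrite le_max lexx.
- by rewrite ge_max root_height ge_min lexx orbT.
by move=> /noc.
Qed.

Lemma arc_point_height a x : w U <= x <= height a -> height (arc_point a x) = x.
Proof. by case/andP=> Ux xa; rewrite (arc_pointP a x).2 min_l// max_r. Qed.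

Lemma arc_pointK a c : ancestor c a -> arc_point a (height c) = c.
Proof.
move=> ca; apply: (ancestor_eq (arc_pointP a _).1 ca).
by rewrite arc_point_height// root_height ancestor_height.
Qed.

(** By [ancestor_dist] the distance between two arc points is the difference of their clamped
    heights, and clamping is 1-Lipschitz. *)
Lemma continuous_arc_point a : continuous (arc_point a).
Proof.
move=> x; apply/(@cvg_ballP _ _ _ (nbhs x) _) => e e0.
near=> y; rewrite ballEmdist /=.
rewrite (ancestor_dist (arc_pointP a x).1 (arc_pointP a y).1).
rewrite (arc_pointP a x).2 (arc_pointP a y).2.
have : `|x - y| < e by near: y; exact: nbhsx_ballx.
rewrite !ltr_norml.
have Uh := root_height a.
have [] := leP x (height a); have [] := leP y (height a).
- by have [] := leP (w U) x; have [] := leP (w U) y; lra.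
- by rewrite (max_r Uh); have [] := leP (w U) x; lra.
- by rewrite (max_r Uh); have [] := leP (w U) y; lra.
- by lra.
Unshelve. all: by end_near.
Qed.

(** The distance to the root is the height above the minimum, so a geodesic from the root gains
    height at unit speed, and the distance left to [a] is the height left to gain. *)
Lemma tree_arc_root a : tree_arc (tree_proj w U) a = [set c | ancestor c a].
Proof.
have dE c : mdist (tree_proj w U) c = height c - w U.
  by rewrite (root_ancestor c) height_proj.
apply/seteqP; split => [c [g [g0 gd gi] [x /=]]|c /= ca].
  rewrite in_itv /= => xd gx; rewrite -gx /ancestor.
  have d0 := mdist_ge0 (tree_proj w U) a.
  have gx0 := gi 0 x; rewrite g0 lexx /= d0 xd dE in gx0.
  have := gi x (mdist (tree_proj w U) a); rewrite gd lexx d0 xd.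
  move=> /(_ isT isT) ->; rewrite ler0_norm; last by move: xd; lra.
  have := gx0 isT isT; rewrite sub0r normrN ger0_norm; last by move: xd; lra.
  by rewrite dE; lra.
(* Conversely, the chain of ancestors, parametrised by height above the minimum, is a geodesic. *)
exists (fun x => arc_point a (w U + x)).
  split.
  - rewrite addr0 -[X in arc_point a X](height_proj w U) arc_pointK//.
    exact: root_ancestor.
  - rewrite dE addrCA subrr addr0 arc_pointK//; exact: ancestorxx.
  move=> x y; rewrite !dE => xa ya.
  rewrite (ancestor_dist (arc_pointP a _).1 (arc_pointP a _).1).
  rewrite !arc_point_height; [|lra..].
  by congr `|_|; lra.
exists (height c - w U) => /=.
  by rewrite in_itv /= dE subr_ge0 root_height lerD2r ancestor_height.
by rewrite addrCA subrr addr0 arc_pointK.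
Qed.

End root.

(** * First and last visits *)

Section visits.
Context (R : realType) (w : continuousType (time R) R).
Implicit Types (s t : time R) (a b c : tree w).

Lemma continuous_proj_nearest : continuous (tree_proj w \o @nearest_time R).
Proof.
move=> x; apply: continuous_comp; first exact: continuous_nearest_time.
exact: continuous_tree_proj.
Qed.

Lemma compact_visits a : compact (visits a).
Proof.
rewrite (_ : visits a =
    `[0, 1]%classic `&` ((tree_proj w \o @nearest_time R) @^-1` [set a])).
  apply: (subclosed_compact _ (@segment_compact R 0 1)); last by move=> x [].
  apply: closedI; first exact: interval_closed.
  apply: closed_comp; last exact: closed_point.
  by move=> x _; exact: continuous_proj_nearest.
apply/seteqP; split => [x ax|x [/=]].
  split; first by rewrite /= in_itv /=; exact: visits01 ax.
  by case: ax => t /= <- <-; rewrite nearest_timeK.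
rewrite in_itv /= => x01 xa; exists (nearest_time x) => //.
exact: nearest_timeE.
Qed.

Lemma visits_proj t : visits (tree_proj w t) t.
Proof. by exists t. Qed.

Lemma first_visit_le t : (first_visit (tree_proj w t) <= t :> R).
Proof.
rewrite /first_visit [leLHS]/time_val set_valE /=.
apply: ge_inf; last exact: visits_proj.
by exists 0 => y /visits01/andP[].
Qed.

Lemma last_visit_ge t : (t <= last_visit (tree_proj w t) :> R).
Proof.
rewrite /last_visit [leRHS]/time_val set_valE /=.
apply: ub_le_sup; last exact: visits_proj.
by exists 1 => y /visits01/andP[].
Qed.

(** The set of visits is compact, so its infimum is itself a visit. *)
Lemma first_visitK : cancel (@first_visit R w) (tree_proj w).
Proof.
move=> a; have [|c /set_mem[t ta tc] cmin] :=
    @compact_EVT_min R R id (visits a) (visits_neq0 a) (@compact_visits a).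
  by apply: continuous_subspaceT => x; exact: cvg_id.
suff <- : t = first_visit a by exact: ta.
apply/val_inj/eqP; rewrite eq_le; apply/andP; split.
  rewrite [leRHS]/= -[leLHS]/(time_val t) tc.
  by apply: lb_le_inf; [exact: visits_neq0|move=> y /mem_set /cmin].
rewrite -[leRHS]/(time_val t) -[leLHS]/(time_val (first_visit a)) -{1}ta.
exact: first_visit_le.
Qed.

Lemma last_visitK : cancel (@last_visit R w) (tree_proj w).
Proof.
move=> a; have [|c /set_mem[t ta tc] cmax] :=
    @compact_EVT_max R R id (visits a) (visits_neq0 a) (@compact_visits a).
  by apply: continuous_subspaceT => x; exact: cvg_id.
suff <- : t = last_visit a by exact: ta.
apply/val_inj/eqP; rewrite eq_le; apply/andP; split.
  rewrite -[leLHS]/(time_val t) -[leRHS]/(time_val (last_visit a)) -{1}ta.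
  exact: last_visit_ge.
rewrite [leLHS]/= -[leRHS]/(time_val t) tc.
by apply: ge_sup; [exact: visits_neq0|move=> y /mem_set /cmax].
Qed.

(** A point is first visited by time [x] exactly when it is the projection of some time up to [x];
    the image of these times is compact. *)
Lemma closed_first_visit_le (x : R) :
  closed [set a : tree w | (first_visit a <= x :> R)].
Proof.
rewrite (_ : [set a | _] =
    (tree_proj w \o @nearest_time R) @` (`[0, 1]%classic `&` `]-oo, x]%classic)).
  apply: compact_closed; first exact: metric_hausdorff.
  apply: continuous_compact.
    by apply: continuous_subspaceT; exact: continuous_proj_nearest.
  apply: (subclosed_compact _ (@segment_compact R 0 1)); last by move=> y [].
  by apply: closedI; exact: interval_closed.
apply/seteqP; split => [a /= ax|c /= [y [/=]]].
  exists (first_visit a); last by rewrite nearest_timeK first_visitK.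
  by split; rewrite /= in_itv //=; exact: time_itv.
rewrite !in_itv /= => y01 yx <-; apply: (le_trans (first_visit_le _)).
by rewrite nearest_timeE.
Qed.

Lemma closed_last_visit_ge (x : R) :
  closed [set a : tree w | (x <= last_visit a :> R)].
Proof.
rewrite (_ : [set a | _] =
    (tree_proj w \o @nearest_time R) @` (`[0, 1]%classic `&` `[x, +oo[%classic)).
  apply: compact_closed; first exact: metric_hausdorff.
  apply: continuous_compact.
    by apply: continuous_subspaceT; exact: continuous_proj_nearest.
  apply: (subclosed_compact _ (@segment_compact R 0 1)); last by move=> y [].
  by apply: closedI; exact: interval_closed.
apply/seteqP; split => [a /= ax|c /= [y [/=]]].
  exists (last_visit a); last by rewrite nearest_timeK last_visitK.
  by split; rewrite /= in_itv /= ?andbT //=; exact: time_itv.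
rewrite !in_itv /= andbT => y01 yx <-; apply: le_trans (last_visit_ge _).
by rewrite nearest_timeE.
Qed.

End visits.

(** * The length measure along arcs *)

Section borel.
Context (T : ptopologicalType).

Lemma open_borel (A : set T) : open A -> measurable (A : set (borel T)).
Proof. by move=> oA; exact: sub_sigma_algebra. Qed.

Lemma closed_borel (A : set T) : closed A -> measurable (A : set (borel T)).
Proof.
move=> cA; rewrite -(setCK A); apply: measurableC; apply: open_borel.
exact: closed_openC.
Qed.

Lemma measurable_fun_into_borel d (S : measurableType d) (f : S -> borel T) :
  (forall A : set T, open A -> measurable (f @^-1` A)) -> measurable_fun setT f.
Proof.
move=> fo.
apply: (@measurability _ _ _ (borel T) _ _ (@open T) erefl) => _ [A oA <-].
by rewrite setTI; exact: fo.
Qed.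

Lemma continuous_borel_measurable (R : realType) (f : T -> R) :
  continuous f -> measurable_fun setT (f : borel T -> R).
Proof.
move=> cf; apply: (measurability _ (RGenOInfty.measurableE R)) => _ [_ [x ->] <-].
by rewrite setTI; apply: open_borel; apply: open_comp => // y _; exact: cf.
Qed.

End borel.

Section borel_tree.
Context (R : realType) (w : continuousType (time R) R).
Implicit Types (a b c : tree w).

(** Open sets of [time R] are traces of open sets of [R], so measurability can be tested on the real
    value. *)
Lemma measurable_fun_into_time d (S : measurableType d) (f : S -> time R) :
  measurable_fun setT (fun s => f s : R) ->
  measurable_fun setT (f : S -> borel (time R)).
Proof.
move=> mf; apply: measurable_fun_into_borel => _ [V oV <-].
rewrite -[X in measurable X]setTI; apply: (mf measurableT V).
exact: open_measurable.
Qed.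

Lemma measurable_first_visit :
  measurable_fun setT (@first_visit R w : borel (tree w) -> borel (time R)).
Proof.
apply: measurable_fun_into_time.
apply: (measurability _ (RGenOInfty.measurableE R)) => _ [_ [x ->] <-].
rewrite setTI -[X in measurable X]setCK; apply: measurableC; apply: closed_borel.
rewrite (_ : ~` _ = [set a | (first_visit a <= x :> R)]); last first.
  by apply/seteqP; split => a /=; rewrite in_itv /= andbT leNgt => /negP.
exact: closed_first_visit_le.
Qed.

Lemma measurable_last_visit :
  measurable_fun setT (@last_visit R w : borel (tree w) -> borel (time R)).
Proof.
apply: measurable_fun_into_time.
apply: (measurability _ (RGenCInfty.measurableE R)) => _ [_ [x ->] <-].
rewrite setTI; apply: closed_borel.
rewrite (_ : _ @^-1` _ = [set a | (x <= last_visit a :> R)]); last first.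
  by apply/seteqP; split => a /=; rewrite in_itv /= andbT.
exact: closed_last_visit_ge.
Qed.

Lemma measurable_tree_proj :
  measurable_fun setT (tree_proj w : borel (time R) -> borel (tree w)).
Proof.
apply: measurable_fun_into_borel => A oA; apply: open_borel.
by apply: open_comp => // t _; exact: continuous_tree_proj.
Qed.

Lemma measurable_height :
  measurable_fun setT (@height R w : borel (tree w) -> R).
Proof. by apply: continuous_borel_measurable; exact: continuous_height. Qed.

Lemma measurable_ancestors a :
  measurable ([set c | ancestor c a] : set (borel (tree w))).
Proof. by apply: closed_borel; exact: closed_ancestors. Qed.

Lemma measurable_arc_point (U : time R)
    (U_min : forall s : time R, w U <= w s) a :
  measurable_fun setT (arc_point U a : R -> borel (tree w)).
Proof.
apply: measurable_fun_into_borel => A oA; apply: open_measurable.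
by apply: open_comp => // x _; exact: continuous_arc_point.
Qed.

End borel_tree.

Lemma lebesgue_measure_itv_le (R : realType) (b : bool) (u v : R) : u <= v ->
  lebesgue_measure [set` Interval (BSide b u) (BRight v)] = (v - u)%:E.
Proof.
rewrite lebesgue_measure_itv /= lte_fin le_eqVlt.
by case: ltP => //= vu; rewrite orbF => /eqP ->; rewrite subrr.
Qed.

Section length.
Context (R : realType) (w : continuousType (time R) R).
Context (U : time R) (U_min : forall s : time R, w U <= w s).
Context (lambda : {measure set (borel (tree w)) -> \bar R}).
Hypothesis lambda_length : is_length_measure (tree_proj w U) lambda.
Implicit Types (s t : time R) (a b c : tree w) (K : set (tree w)).

Lemma length_ancestors a : lambda [set c | ancestor c a] = (height a - w U)%:E.
Proof.
rewrite -(tree_arc_root U_min) lambda_length.2.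
by rewrite (root_ancestor U_min a) height_proj.
Qed.

Lemma length_ancestors_above a (x : R) : w U <= x -> x <= height a ->
  lambda ([set c | ancestor c a] `&` [set c | x < height c]) = (height a - x)%:E.
Proof.
move=> Ux xa; have [pa hp] := arc_pointP U_min a x.
rewrite min_l// max_r// in hp.
set p := arc_point U a x in pa hp.
(* What lies above height [x] is the arc to [a] without the arc to its point [p] at height [x]. *)
rewrite (_ : _ `&` _ = [set c | ancestor c a] `\` [set c | ancestor c p]).
  have -> : lambda ([set c | ancestor c a] `\` [set c | ancestor c p]) =
      (lambda [set c | ancestor c a] -
       lambda ([set c | ancestor c a] `&` [set c | ancestor c p]))%E.
    apply: measureD; [exact: measurable_ancestors..|].
    by have -> : (lambda [set c | ancestor c a] < +oo)%E
      by rewrite length_ancestors ltry.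
  rewrite (_ : _ `&` _ = [set c | ancestor c p]); last first.
    by apply/setIidr => c /= cp; exact: (ancestor_trans cp pa).
  by rewrite !length_ancestors hp -EFinB; congr EFin; lra.
apply/seteqP; split => c /= [ca].
  by move=> xc; split => // /ancestor_height; rewrite hp leNgt xc.
move=> ncp; split => //; rewrite ltNge; apply/negP => cx; apply: ncp.
rewrite /ancestor (ancestor_dist ca pa) hp ler0_norm ?subr_le0//.
by rewrite opprB.
Qed.

(** Both sides are measures in [X]: the push-forward by height of the length on the arc, and
    Lebesgue measure on the interval of heights. They are finite and agree on the half-lines []x,
    +oo[], a pi-system generating the Borel sets. *)
Lemma length_heights a (X : set R) : measurable X ->
  lambda ([set c | ancestor c a] `&` height (w := w) @^-1` X) =
  lebesgue_measure (`[w U, height a]%classic `&` X).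
Proof.
move=> mX.
have mI := @measurable_itv R `[w U, height a].
pose mu1 := @measure_function_pushforward__canonical__measure_function_Measure
  _ _ (borel (tree w)) (measurableTypeR R) _
  (mrestr lambda (measurable_ancestors a)) _ (@measurable_height R w).
pose mu2 := measure_function_mrestr__canonical__measure_function_Measure
  lebesgue_measure mI.
rewrite setIC [in RHS]setIC -[LHS]/(mu1 X) -[RHS]/(mu2 X).
apply: (@measure_unique _ R (measurableTypeR R) (@RGenOInfty.G R)
  (fun n => `](- n%:R), +oo[%classic) (RGenOInfty.measurableE R)
  _ _ _ mu1 mu2 _ _ X mX).
- move=> _ _ [x ->] [y ->]; exists (Num.max x y).
  apply/seteqP; split => z /=; rewrite !in_itv /= !andbT gt_max.
    by case=> -> ->.
  by case/andP.
- by move=> n; exists (- n%:R).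
- rewrite -subTset => x _; exists (Num.truncn (- x)).+1 => //=.
  by rewrite in_itv /= andbT ltrNl truncnS_gt.
- move=> _ [x ->].
  suff : lambda ((@height R w) @^-1` `]x, +oo[%classic `&` [set c | ancestor c a])
      = lebesgue_measure (`]x, +oo[%classic `&` `[w U, height a]%classic) by [].
  (* The half-line contains the interval of heights, misses it, or cuts it at [x]. *)
  have [xU|Ux] := ltP x (w U).
    rewrite (_ : _ `&` _ = [set c | ancestor c a]); last first.
      apply/setIidr => c /= _; rewrite in_itv /= andbT.
      exact: lt_le_trans (root_height U_min c).
    rewrite (_ : _ `&` _ = `[w U, height a]%classic); last first.
      apply/setIidr => y /=; rewrite !in_itv /= andbT => /andP[Uy _].
      exact: lt_le_trans Uy.
    by rewrite length_ancestors lebesgue_measure_itv_le// root_height.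
  have [ax|xa] := ltP (height a) x.
    rewrite (_ : _ `&` _ = set0); last first.
      apply/seteqP; split => // c /= []; rewrite in_itv /= andbT => xc.
      by move=> /ancestor_height; lra.
    rewrite (_ : _ `&` _ = set0); last first.
      by apply/seteqP; split => // y /= []; rewrite !in_itv /=; lra.
    by rewrite !measure0.
  rewrite setIC (_ : [set c | _] `&` _ =
      [set c | ancestor c a] `&` [set c | x < height c]); last first.
    by apply/seteqP; split => c /=; rewrite in_itv /= andbT.
  rewrite (_ : _ `&` _ = `]x, height a]%classic); last first.
    by apply/seteqP; split => y /=; rewrite !in_itv /=; lra.
  by rewrite length_ancestors_above// lebesgue_measure_itv_le.
- move=> n.
  suff : (lambda ((@height R w) @^-1` `](- n%:R)%R, +oo[%classic `&`
      [set c | ancestor c a]) < +oo)%E by [].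
  apply: (@le_lt_trans _ _ (lambda [set c | ancestor c a])).
    apply: le_measure; rewrite ?inE.
    + apply: measurableI; last exact: measurable_ancestors.
      by rewrite -[X in measurable X]setTI; apply: measurable_height.
    + exact: measurable_ancestors.
    + exact: subIsetr.
  by rewrite length_ancestors ltry.
Qed.



End length.

(** * The length measure as an integral over levels *)

Section skeleton.
Context (R : realType) (w : continuousType (time R) R).
Implicit Types (s t : time R) (a b c : tree w).

(** Stated without the root; [tree_leafE] shows that it is the complement of the leaves. *)
Definition skeleton : set (tree w) := [set a | exists b, b <> a /\ ancestor a b].

(** An enumeration with repetitions: codes of no rational give time 0, and rationals outside
    [[0, 1]] are clamped. *)
Definition rational_time (n : nat) : time R :=
  nearest_time (ratr (odflt 0 (unpickle n : option rat))).

(** The upper end is removed because it may be a leaf. *)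
Definition rational_arc (n : nat) : set (tree w) :=
  [set c | ancestor c (tree_proj w (rational_time n))] `\
    tree_proj w (rational_time n).

Lemma rational_timeP (x y : R) : 0 <= x -> x < y -> y <= 1 ->
  exists n, x < (rational_time n : R) < y.
Proof.
move=> x0 xy y1; have [q] := rat_in_itvoo xy; rewrite in_itv /= => /andP[xq qy].
exists (pickle q); rewrite /rational_time pickleK /= nearest_timeE ?xq//.
by rewrite !ltW ?(le_lt_trans x0)//= (lt_le_trans qy).
Qed.

(** If [b] is above [a], the path exceeds [height a] near a visit to [b]; a rational time close to
    that visit, on the side of the visit to [a], projects to a point still above [a]. *)
Lemma skeletonE : skeleton = \bigcup_n rational_arc n.
Proof.
apply/seteqP; split => [a [b [ba ab]]|a [n _ [an na]]]; last first.
  by exists (tree_proj w (rational_time n)); split => //; exact: nesym.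
have hab : height a < height b by apply: ancestor_height_lt ab (nesym ba).
suff [n [nb ha]] : exists n, below (path_fun w) (repr a) (rational_time n) /\
    height a < w (rational_time n).
  exists n => //; split; first by rewrite /= -{1}(proj_repr a) ancestor_proj.
  by move=> /= an; move: ha; rewrite an height_proj ltxx.
have sb : below (path_fun w) (repr a) (repr b) by exact/ancestor_repr.
have e0 : 0 < height b - height a by rewrite subr_gt0.
have /cvgrPdist_lt/(_ _ e0) cb := @continuous_path_fun R w (time_val (repr b)).
have {cb}[d /= d0 db] := (nbhs_ballP _ _).1 cb.
have {}db (y : R) : time_val (repr b) - d < y < time_val (repr b) + d ->
    height a < path_fun w y.
  move=> yb; have /db : ball (time_val (repr b)) d y.
    by rewrite /ball /= ltr_norml; lra.
  by rewrite ltr_norml path_funE -/(height b); lra.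
have := time_itv (repr a); have := time_itv (repr b).
have [st|ts|st] := ltgtP (repr a : R) (repr b : R) => b01 a01.
- have [|||n xn] := @rational_timeP
    (Num.max (repr a : R) (time_val (repr b) - d)) (time_val (repr b)).
  + by rewrite le_max; lra.
  + by rewrite gt_max; lra.
  + by lra.
  move: xn; rewrite gt_max => xn; exists n.
  split; last by rewrite -path_funE; apply: db; lra.
  by move=> u un; apply: sb; lra.
- have [|||n xn] := @rational_timeP
    (time_val (repr b)) (Num.min (repr a : R) (time_val (repr b) + d)).
  + by lra.
  + by rewrite lt_min; lra.
  + by rewrite ge_min; lra.
  move: xn; rewrite [X in _ && X]lt_min => xn; exists n.
  split; last by rewrite -path_funE; apply: db; lra.
  by move=> u un; apply: sb; lra.
- by move: hab; rewrite /height -(path_funE _ (repr a)) st path_funE ltxx.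
Qed.

Lemma measurable_rational_arc n :
  measurable (rational_arc n : set (borel (tree w))).
Proof.
apply: measurableD; first exact: measurable_ancestors.
apply: closed_borel; exact: closed_point.
Qed.

Lemma measurable_seqDU_arc n :
  measurable (seqDU rational_arc n : set (borel (tree w))).
Proof.
apply: measurableD; first exact: measurable_rational_arc.
by apply: bigsetU_measurable => i _; exact: measurable_rational_arc.
Qed.

Lemma seqDU_arc_ancestor n c :
  seqDU rational_arc n c -> ancestor c (tree_proj w (rational_time n)).
Proof. by case=> -[]. Qed.

Lemma seqDU_arc_inj n c c' :
  seqDU rational_arc n c -> seqDU rational_arc n c' ->
  height c = height c' -> c = c'.
Proof. by move=> /seqDU_arc_ancestor + /seqDU_arc_ancestor; exact: ancestor_eq. Qed.

Lemma measurable_skeleton : measurable (skeleton : set (borel (tree w))).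
Proof.
rewrite skeletonE; apply: bigcup_measurable => n _; exact: measurable_rational_arc.
Qed.

Section length.
Context (U : time R) (U_min : forall s : time R, w U <= w s).
Context (lambda : {measure set (borel (tree w)) -> \bar R}).
Hypothesis lambda_length : is_length_measure (tree_proj w U) lambda.

Lemma tree_leafE : tree_leaf (tree_proj w U) = ~` skeleton.
Proof.
apply/seteqP; split => a na [b [ba ab]]; apply: na; exists b; split => //.
  by rewrite /tree_above tree_arc_root.
by move: ab; rewrite /tree_above tree_arc_root.
Qed.

(** A forward image is not measurable in general; here it is a preimage by [arc_point], the
    continuous inverse of the height along the arc. *)
Lemma measurable_height_image a (K : set (borel (tree w))) : measurable K ->
  K `<=` [set c | ancestor c a] -> measurable (@height R w @` K).
Proof.
move=> mK Ka; rewrite (_ : _ @` _ =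
    `[w U, height a]%classic `&` arc_point U a @^-1` K).
  apply: measurableI; first exact: measurable_itv.
  by rewrite -[X in measurable X]setTI; apply: (measurable_arc_point U_min).
apply/seteqP; split => [_ [c Kc <-]|x [/=]].
  split; last by rewrite /= arc_pointK//; exact: Ka.
  by rewrite /= in_itv /= root_height//= ancestor_height//; exact: Ka.
rewrite in_itv /= => xa Kx; exists (arc_point U a x) => //.
exact: arc_point_height.
Qed.

(** The height is injective on the arc, so [K] is the part of the arc whose heights lie in the image
    of [K]. *)
Lemma length_height_image a (K : set (borel (tree w))) : measurable K ->
  K `<=` [set c | ancestor c a] -> lambda K = lebesgue_measure (@height R w @` K).
Proof.
move=> mK Ka; have mX := measurable_height_image mK Ka.
transitivity (lambda ([set c | ancestor c a] `&`
    @height R w @^-1` (@height R w @` K))).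
  congr (lambda _); apply/seteqP; split => [c Kc|c [/= ca [c' Kc' cc']]].
    by split; [exact: Ka|exists c].
  by rewrite -(ancestor_eq (Ka _ Kc') ca cc').
rewrite (length_heights U_min lambda_length)//; congr lebesgue_measure.
apply/setIidr => _ /= [c Kc <-].
by rewrite in_itv /= root_height//= ancestor_height//; exact: Ka.
Qed.

(** A counting measure written with Dirac masses, to match the integrand of [level_measure]. *)
Definition level_count (C : set (tree w)) (x : R) : \bar R :=
  (\esum_(a in skeleton `&` [set a | height a = x]) dirac (a : borel (tree w)) C)%E.

(** The rational arcs, made disjoint, each meet a level in at most one point. The count thus becomes
    a countable sum of indicators. *)
Lemma level_countE C x : level_count C x =
  (\sum_(n <oo) (\1_(@height R w @` (C `&` seqDU rational_arc n)) x)%:E)%E.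
Proof.
rewrite /level_count skeletonE seqDU_bigcup_eq setI_bigcupl esum_bigcupT.
- rewrite nneseries_esumT//; apply: eq_esum => n _.
  rewrite indicE; case: (boolP (x \in _)) => [/set_mem[c [Cc Sc] cx]|/negP xC].
    rewrite (_ : _ `&` _ = [set c]).
      by rewrite esum_set1 ?diracE ?mem_set.
    apply/seteqP; split => [c' [Sc' /= c'x]|_ ->] //.
    by apply: seqDU_arc_inj Sc' Sc _; rewrite c'x.
  apply: esum1 => c [Sc /= cx]; rewrite diracE memNset// => Cc.
  by apply: xC; apply/mem_set; exists c.
- by apply: trivIset_setIr; exact: trivIset_seqDU.
- by move=> c; rewrite diracE lee_fin ler0n.
Qed.

Lemma measurable_level_count (C : set (borel (tree w))) : measurable C ->
  measurable_fun setT (level_count C).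
Proof.
move=> mC; rewrite (funext (level_countE C)).
apply: ge0_emeasurable_sum => // n _.
apply/measurable_EFinP/measurable_indic.
apply: (@measurable_height_image (tree_proj w (rational_time n))).
  by apply: measurableI => //; exact: measurable_seqDU_arc.
by move=> c [_ /seqDU_arc_ancestor].
Qed.

(** On each disjoint piece the length is the Lebesgue measure of the heights, that is, the integral
    of an indicator; the sum over pieces passes under the integral because the terms are
    nonnegative. *)
Lemma length_level_count (C : set (borel (tree w))) : measurable C ->
  lambda C = (\int[lebesgue_measure]_(x in [set: R]) level_count C x)%E.
Proof.
move=> mC.
have mCn n : measurable (C `&` seqDU rational_arc n).
  by apply: measurableI => //; exact: measurable_seqDU_arc.
have Cn n : C `&` seqDU rational_arc n `<=`
    [set c | ancestor c (tree_proj w (rational_time n))].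
  by move=> c [_ /seqDU_arc_ancestor].
under eq_integral do rewrite level_countE.
rewrite integral_nneseries//; last first.
  move=> n; apply/measurable_EFinP/measurable_indic.
  exact: (measurable_height_image (mCn n) (@Cn n)).
(* The part of [C] off the skeleton consists of leaves and is null. *)
transitivity (lambda (C `&` skeleton)).
  have mS := measurable_skeleton.
  rewrite -[in LHS](setUIDK C skeleton) measureU0//.
  - exact: measurableI.
  - exact: measurableD.
  - apply/eqP; rewrite eq_le measure_ge0 andbT -lambda_length.1 tree_leafE.
    apply: le_measure; rewrite ?inE.
    + exact: measurableD.
    + exact: measurableC.
    + by move=> c [].
rewrite skeletonE seqDU_bigcup_eq setI_bigcupr measure_semi_bigcup//; last 2 first.
- by apply: trivIset_setIl; exact: trivIset_seqDU.
- by apply: bigcup_measurable => n _.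
apply: eq_eseriesr => n _.
rewrite integral_indic ?setIT//; first exact: length_height_image (mCn n) (@Cn n).
exact: (measurable_height_image (mCn n) (@Cn n)).
Qed.

End length.

End skeleton.

(** * Images by the first and last visits *)

(** Every subset of a countable set of reals is Borel, so the values on [D] cannot spoil
    measurability. *)
Lemma measurable_fun_eq_off_countable (R : realType) d (S : measurableType d)
    (D : set R) (f g : R -> S) :
  countable D -> (forall x, ~ D x -> f x = g x) ->
  measurable_fun setT g -> measurable_fun setT f.
Proof.
move=> cD fg mg _ Y mY; rewrite setTI.
have mc (X : set R) : countable X -> measurable X.
  by apply: countable_measurable => x; exact: measurable_set1.
rewrite (_ : f @^-1` Y = (g @^-1` Y `\` D) `|` (f @^-1` Y `&` D)).
  apply: measurableU; last first.
    by apply: mc; apply: sub_countable cD; apply: subset_card_le; exact: subIsetr.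
  apply: measurableD; last exact: mc.
  by rewrite -[X in measurable X]setTI; exact: mg.
apply/seteqP; split => x /=.
  have [Dx fY|nDx] := pselect (D x); first by right.
  by rewrite fg//; left.
by case=> [[gY /fg ->]|[]].
Qed.

Section image.
Context (R : realType) (w : continuousType (time R) R).
Context (U : time R) (U_min : forall s : time R, w U <= w s).
Context (lambda : {measure set (borel (tree w)) -> \bar R}).
Hypothesis lambda_length : is_length_measure (tree_proj w U) lambda.
Implicit Types (s t : time R) (a b c : tree w).
(** Common setting for both directions of time: [E] stands for the beginnings or ends of excursions,
    [f] for the first or last visit, [P] for the projection of time 0 or 1, and [D] for the
    exceptional levels. *)
Context (E : set (time R)) (f : tree w -> time R) (P : tree w) (D : set R).
Hypothesis countable_D : countable D.
Hypothesis mf : measurable_fun setT (f : borel (tree w) -> borel (time R)).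
Hypothesis fK : cancel f (tree_proj w).
Hypothesis E_f : forall s, E s -> ~ D (w s) ->
  [/\ f (tree_proj w s) = s, skeleton (tree_proj w s) &
      ~ ancestor (tree_proj w s) P].
Hypothesis f_E :
  forall a, skeleton a -> ~ ancestor a P -> ~ D (height a) -> E (f a).

(** At a level off [D], [f] is a bijection from the skeleton points off the arc to [P] onto the
    points of [E], with inverse the projection. Since [D] is Lebesgue null, the integrals over
    levels agree. *)
Lemma level_measure_image (A : set (borel (time R))) : measurable A ->
  level_measure w E A = lambda (f @^-1` A `&` ~` tree_arc (tree_proj w U) P).
Proof.
move=> mA; rewrite tree_arc_root//.
have mC : measurable
    (f @^-1` A `&` ~` [set c | ancestor c P] : set (borel (tree w))).
  apply: measurableI; first by rewrite -[X in measurable X]setTI; exact: mf.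
  by apply: measurableC; exact: measurable_ancestors.
set C := _ `&` _ in mC *.
pose F (x : R) : \bar R :=
  (\esum_(s in E `&` [set s | w s = x]) dirac (s : borel (time R)) A)%E.
have FE x : ~ D x -> F x = level_count C x.
  move=> nDx; rewrite /F (@reindex_esum _ _ _
    ((@skeleton R w `&` [set a | height a = x]) `&`
      ~` [set c | ancestor c P]) _ f); last first.
    split=> [a [[ska ax] na]|a b _ _ /(congr1 (tree_proj w))|s]; [|by rewrite !fK|].
    - split; last by rewrite /= -height_proj fK.
      by apply: f_E => //; rewrite ax.
    - move=> [Es /= sx]; have [|fs sk ns] := E_f Es; first by rewrite sx.
      by exists (tree_proj w s) => //; do 2 split => //=; rewrite height_proj.
  rewrite esum_mkcondr /level_count; apply: eq_esum => a _.
  rewrite !diracE; case: ifPn => [/set_mem na|/negP na].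
    congr (_%:R%:E); congr nat_of_bool.
    by apply/idP/idP => /set_mem fa; apply/mem_set => //; case: fa.
  by rewrite [in RHS]memNset// => -[_ /mem_set].
rewrite (length_level_count U_min lambda_length mC) /level_measure -/F.
have mG := measurable_level_count U_min mC.
have esum_dirac_ge0 (T : pointedType) (V : set (set T)) (I : set T) (B : set T) :
    (0 <= \esum_(t in I) dirac (t : g_sigma_algebraType V) B :> \bar R)%E.
  by apply: esum_ge0 => t _; rewrite diracE lee_fin.
apply: ge0_ae_eq_integral => //.
- exact: measurable_fun_eq_off_countable FE mG.
- by move=> x _; exact: esum_dirac_ge0.
- by move=> x _; exact: esum_dirac_ge0.
- exists D; split.
  + by apply: countable_measurable => // x; exact: measurable_set1.
  + exact: countable_lebesgue_measure0.
  + by move=> x /= nFx; apply: contrapT => nDx; apply: nFx => _; exact: FE.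
Qed.

(** As [f] is a section of the projection, projecting the image measure back gives the restricted
    length measure; this also transfers sigma-finiteness. *)
Lemma level_measure_is_image :
  [/\ sigma_finite setT (level_measure w E),
      is_image lambda (level_measure w E) (~` tree_arc (tree_proj w U) P) f &
      is_image (level_measure w E)
        (restrict_measure lambda (~` tree_arc (tree_proj w U) P))
        setT (tree_proj w)].
Proof.
have mN : measurable (~` tree_arc (tree_proj w U) P : set (borel (tree w))).
  by rewrite tree_arc_root//; apply: measurableC; exact: measurable_ancestors.
have mpi (C : set (borel (tree w))) : measurable C ->
    measurable (tree_proj w @^-1` C : set (borel (time R))).
  move=> mC; rewrite -[X in measurable X]setTI.
  exact: measurable_tree_proj.
have piE (C : set (borel (tree w))) : measurable C ->
    level_measure w E (tree_proj w @^-1` C) =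
    lambda (C `&` ~` tree_arc (tree_proj w U) P).
  move=> mC; rewrite level_measure_image; last exact: mpi.
  by congr (lambda (_ `&` _)); apply/seteqP; split => a /=; rewrite fK.
split.
(* The cover is pulled back from the tree: index 0 holds the null set of leaves, index [n + 1] an
   arc of finite length. *)
- pose F n : set (borel (tree w)) :=
    if n is n'.+1 then @rational_arc R w n' else ~` @skeleton R w.
  have mF n : measurable (F n).
    case: n => [|n] /=; first by apply: measurableC; exact: measurable_skeleton.
    exact: measurable_rational_arc.
  exists (fun n => tree_proj w @^-1` F n).
    rewrite -preimage_bigcup; apply/esym; rewrite -subTset => s _ /=.
    have [|nsk] := pselect (skeleton (tree_proj w s)).
      by rewrite skeletonE => -[n _ sn]; exists n.+1.
    by exists 0%N.
  move=> n; split; first exact: mpi.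
  rewrite piE//; apply: (@le_lt_trans _ _ (lambda (F n))).
    by apply: le_measure; rewrite ?inE//; exact: measurableI.
  case: n => [|n] /=.
    rewrite -(tree_leafE U_min) lambda_length.1; exact: ltry.
  apply: (@le_lt_trans _ _
    (lambda [set c | ancestor c (tree_proj w (rational_time R n))])).
    apply: le_measure; rewrite ?inE; [exact: (mF n.+1)|exact: measurable_ancestors|].
    exact: subDsetl.
  by rewrite (length_ancestors U_min lambda_length) ltry.
- split => //; first exact: measurable_funTS.
  by move=> A mA; exact: level_measure_image.
- split => //; first exact: measurable_tree_proj.
  by move=> C mC; rewrite /restrict_measure setIT piE.
Qed.

End image.

(** * Beginnings and ends of excursions *)

Section excursion_images.
Context (R : realType) (w : continuousType (time R) R).
Context (U : time R) (U_min : forall s : time R, w U <= w s).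
Context (lambda : {measure set (borel (tree w)) -> \bar R}).
Hypothesis lambda_length : is_length_measure (tree_proj w U) lambda.
Implicit Types (s t : time R) (a b c : tree w).

Lemma exc_beginE s : exc_begin w s <-> excursion_start (path_fun w) s.
Proof.
split=> -[s1 [e e0 se]]; split => //; exists e => //.
  move=> y sy y1; rewrite path_funE; apply: se.
  by rewrite nearest_timeE//; have := time_itv s; lra.
move=> y sy; rewrite -!path_funE; apply: se => //.
by have := time_itv y; lra.
Qed.

(** Time reversal turns ends of excursions into beginnings and last visits into first ones, and
    preserves [below]. *)
Let rev_path (x : R) : R := path_fun w (1 - x).

Let continuous_rev_path : continuous rev_path.
Proof.
move=> x; apply: (@continuous_comp _ _ _ (fun x : R => 1 - x) (path_fun w)).
  by apply: continuousB => //; exact: cvg_cst.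
exact: continuous_path_fun.
Qed.

Lemma exc_endE s : exc_end w s <-> excursion_start rev_path (1 - (s : R)).
Proof.
rewrite /excursion_start /rev_path; have := time_itv s.
split=> -[s1 [e e0 se]].
  split; first lra.
  exists e => // y sy y1; rewrite subKr path_funE; apply: se.
  by rewrite nearest_timeE//; lra.
split; first lra.
exists e => // y sy; rewrite -!path_funE -(subKr 1 (y : R)) -{1}(subKr 1 (s : R)).
by apply: se; have := time_itv y; lra.
Qed.

Lemma below_rev (c a : R) :
  below rev_path (1 - c) (1 - a) <-> below (path_fun w) c a.
Proof.
rewrite /rev_path; split => h u cu.
  by have := h (1 - u); rewrite !subKr; apply; lra.
by rewrite subKr; apply: h; lra.
Qed.

Lemma skeleton_below t (v : time R) : below (path_fun w) t v -> w t < w v ->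
  skeleton (tree_proj w t).
Proof.
move=> tv wtv; exists (tree_proj w v); split; last exact/ancestor_proj.
move=> /(congr1 (@height R w)); rewrite !height_proj => e.
by move: wtv; rewrite e ltxx.
Qed.

Lemma below_same_point t (r : time R) : below (path_fun w) t r -> w r = w t ->
  tree_proj w r = tree_proj w t.
Proof.
move=> /ancestor_proj tr wrt; apply/esym/(ancestor_eq tr (ancestorxx _)).
by rewrite !height_proj.
Qed.

Lemma begin_measure_is_image :
  [/\ sigma_finite setT (begin_measure w),
      is_image lambda (begin_measure w)
        (~` tree_arc (tree_proj w U) (tree_proj w (time0 R))) (@first_visit R w) &
      is_image (begin_measure w)
        (restrict_measure lambda
          (~` tree_arc (tree_proj w U) (tree_proj w (time0 R))))
        setT (tree_proj w)].
Proof.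
have cf := @continuous_path_fun R w.
apply: (level_measure_is_image U_min lambda_length
  (countable_turning_levels (path_fun w)) (@measurable_first_visit R w)
  (@first_visitK R w)).
(* A beginning at a level without local minimum is a first visit, to a skeleton point off the
   arc. *)
- move=> s /exc_beginE es; rewrite -path_funE => ws.
  have := time_itv s => /andP[s0 s1]; split.
  + apply/val_inj/eqP; rewrite eq_le; apply/andP; split; first exact: first_visit_le.
    apply: (excursion_start_no_earlier s0 es ws).
      by case/andP: (time_itv (first_visit (tree_proj w s))).
    by apply/ancestor_proj; rewrite first_visitK; exact: ancestorxx.
  + have [v [sv v1 wsv bsv]] := excursion_start_above es.
    have vE : nearest_time v = v :> R by rewrite nearest_timeE//; lra.
    by apply: (@skeleton_below s (nearest_time v)); rewrite ?vE// -!path_funE vE.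
  + move=> /ancestor_proj; exact: (excursion_start_not_below0 s0 es ws).
- move=> a [b [ba ab]] na wa; apply/exc_beginE.
  have wf : path_fun w (first_visit a) = height a.
    by rewrite path_funE -height_proj first_visitK.
  apply: (@first_excursion_start _ _ _ (repr b) cf); rewrite ?wf ?path_funE//.
  + exact: time_itv.
  (* If [r] is a time, [tr] and [wr] make it another visit to [a]; beyond 1 it comes after every
     visit. *)
  + move=> r r0 tr wr; have [r1|r1] := leP r 1; last first.
      by have := time_itv (first_visit a); lra.
    have rE : nearest_time r = r :> R by rewrite nearest_timeE ?r0.
    rewrite -rE -[X in first_visit X](_ : tree_proj w (nearest_time r) = a).
      exact: first_visit_le.
    rewrite -[RHS]first_visitK; apply: below_same_point; rewrite ?rE//.
    by rewrite -!path_funE rE wr wf.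
  + exact: time_itv.
  + by apply/ancestor_proj; rewrite first_visitK proj_repr.
  + exact: (ancestor_height_lt ab (nesym ba)).
  + by move=> t0; apply: na; rewrite -(first_visitK a); apply/ancestor_proj.
Qed.

Lemma end_measure_is_image :
  [/\ sigma_finite setT (end_measure w),
      is_image lambda (end_measure w)
        (~` tree_arc (tree_proj w U) (tree_proj w (time1 R))) (@last_visit R w) &
      is_image (end_measure w)
        (restrict_measure lambda
          (~` tree_arc (tree_proj w U) (tree_proj w (time1 R))))
        setT (tree_proj w)].
Proof.
have rE (x : R) : rev_path (1 - x) = path_fun w x by rewrite /rev_path subKr.
have belowE (x y : R) : below rev_path (1 - x) y <-> below (path_fun w) x (1 - y).
  by rewrite -below_rev subKr.
have t1E : time_val (time1 R) = 1 by [].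
apply: (level_measure_is_image U_min lambda_length
  (countable_turning_levels rev_path) (@measurable_last_visit R w)
  (@last_visitK R w)).
- move=> s /exc_endE es; rewrite -path_funE -rE => ws.
  have := time_itv s => /andP[s0 s1]; have s0' : 0 <= 1 - (s : R) by lra.
  split.
  + apply/val_inj/eqP; rewrite eq_le; apply/andP; split; last exact: last_visit_ge.
    suff : 1 - time_val s <= 1 - time_val (last_visit (tree_proj w s)).
      by rewrite lerD2l lerN2.
    apply: (excursion_start_no_earlier s0' es ws).
      by have := time_itv (last_visit (tree_proj w s)); lra.
    by apply/below_rev/ancestor_proj; rewrite last_visitK; exact: ancestorxx.
  + have [v [sv v1 wsv bsv]] := excursion_start_above es.
    have vE : nearest_time (1 - v) = 1 - v :> R by rewrite nearest_timeE//; lra.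
    apply: (@skeleton_below s (nearest_time (1 - v))); rewrite ?vE; first exact/belowE.
    by rewrite -!path_funE vE -(rE s).
  + move=> /ancestor_proj; rewrite t1E => s1'.
    apply: (excursion_start_not_below0 s0' es ws).
    by apply/belowE; rewrite subr0.
- move=> a [b [ba ab]] na wa; apply/exc_endE.
  have wf : rev_path (1 - time_val (last_visit a)) = height a.
    by rewrite rE path_funE -height_proj last_visitK.
  apply: (@first_excursion_start _ _ _ (1 - time_val (repr b)) continuous_rev_path);
    rewrite ?wf ?rE ?path_funE//.
  + by have := time_itv (last_visit a); lra.
  + move=> r r0 /belowE tr wr; have [r1|r1] := leP r 1; last first.
      by have := time_itv (last_visit a); lra.
    have rE' : nearest_time (1 - r) = 1 - r :> R by rewrite nearest_timeE//; lra.
    (* In original time, [1 - r] is a visit to [a], so it cannot come after the last one. *)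
    suff : 1 - r <= time_val (last_visit a) by lra.
    rewrite -rE'.
    rewrite -[X in last_visit X](_ : tree_proj w (nearest_time (1 - r)) = a).
      exact: last_visit_ge.
    rewrite -[RHS]last_visitK; apply: below_same_point; rewrite ?rE'//.
    by rewrite -!path_funE rE' -/(rev_path r) wr -wf rE.
  + by have := time_itv (repr b); lra.
  + by apply/below_rev/ancestor_proj; rewrite last_visitK proj_repr.
  + exact: (ancestor_height_lt ab (nesym ba)).
  + move=> /belowE; rewrite subr0 => t0; apply: na.
    by rewrite -(last_visitK a); apply/ancestor_proj.
Qed.

Lemma length_arc_null a :
  height a = w U -> lambda (tree_arc (tree_proj w U) a) = 0%E.
Proof.
move=> aU; rewrite lambda_length.2.
by rewrite (root_ancestor U_min a) height_proj aU subrr.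
Qed.

(** An arc from the root to a point at minimal height has length zero, so removing it changes no
    length. *)
Lemma length_setI_null_arcC a (X : set (borel (tree w))) :
  height a = w U -> measurable X ->
  lambda (X `&` ~` tree_arc (tree_proj w U) a) = lambda X.
Proof.
move=> aU mX.
have mA : measurable (tree_arc (tree_proj w U) a : set (borel (tree w))).
  by rewrite tree_arc_root//; exact: measurable_ancestors.
rewrite -[in RHS](setUIDK X (~` tree_arc (tree_proj w U) a)) measureU0//.
- by apply: measurableI => //; exact: measurableC.
- by apply: measurableD => //; exact: measurableC.
- apply/eqP; rewrite eq_le measure_ge0 andbT -(length_arc_null aU).
  apply: le_measure; rewrite ?inE//.
    by apply: measurableD => //; exact: measurableC.
  by move=> c [_ /contrapT].
Qed.

End excursion_images.

Theorem proposition2p2 (R : realType) (w : continuousType (time R) R)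
    (w_nonconstant : exists s t : time R, w s <> w t)
    (U : time R) (U_min : forall s : time R, w U <= w s)
    (lambda : {measure set (borel (tree w)) -> \bar R})
    (lambda_length : is_length_measure (tree_proj w U) lambda) :
  let O := tree_proj w U in
  let A := tree_proj w (time0 R) in
  let B := tree_proj w (time1 R) in
  let ends_at_min := w (time0 R) = inf (range w) /\
                     w (time1 R) = inf (range w) in
  (ends_at_min ->
    [/\ sigma_finite setT (begin_measure w),
        sigma_finite setT (end_measure w) &
        [/\ is_image lambda (begin_measure w) setT (@first_visit R w),
            is_image lambda (end_measure w) setT (@last_visit R w),
            is_image (begin_measure w) lambda setT (tree_proj w) &
            is_image (end_measure w) lambda setT (tree_proj w)]]) /\
  (~ ends_at_min ->
    [/\ sigma_finite setT (begin_measure w),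
        is_image lambda (begin_measure w) (~` tree_arc O A) (@first_visit R w) &
        is_image (begin_measure w) (restrict_measure lambda (~` tree_arc O A))
          setT (tree_proj w)] /\
    [/\ sigma_finite setT (end_measure w),
        is_image lambda (end_measure w) (~` tree_arc O B) (@last_visit R w) &
        is_image (end_measure w) (restrict_measure lambda (~` tree_arc O B))
          setT (tree_proj w)]).
Proof.
move=> O A B ends_at_min.
have bI := begin_measure_is_image U_min lambda_length.
have eI := end_measure_is_image U_min lambda_length.
(* The restricted relations hold for every path. When both ends are at the minimum, the two removed
   arcs are null, and the restriction disappears. *)
split=> [[w0 w1]|_]; last by split.
have UE : inf (range w) = w U.
  apply/eqP; rewrite eq_le; apply/andP; split.
    by apply: ge_inf; [exists (w U) => _ [s _ <-]|exists U].
  by apply: lb_le_inf; [exists (w U), U|move=> _ [s _ <-]].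
have hA : height A = w U by rewrite height_proj w0.
have hB : height B = w U by rewrite height_proj w1.
have arcD a (X : set (borel (tree w))) : height a = w U -> measurable X ->
    lambda (X `&` ~` tree_arc O a) = lambda X.
  exact: length_setI_null_arcC.
have [bs [_ _ bE] [_ mpi bpi]] := bI; have [es [_ _ eE] [_ _ epi]] := eI.
have mfirst :
    measurable_fun setT (@first_visit R w : borel (tree w) -> borel (time R)).
  exact: measurable_first_visit.
have mlast :
    measurable_fun setT (@last_visit R w : borel (tree w) -> borel (time R)).
  exact: measurable_last_visit.
split => //; split; split => // X mX.
- rewrite bE// /restrict_measure setIT arcD//.
  by rewrite -[X in measurable X]setTI; exact: mfirst.
- rewrite eE// /restrict_measure setIT arcD//.
  by rewrite -[X in measurable X]setTI; exact: mlast.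
- by rewrite -bpi// /restrict_measure arcD.
- by rewrite -epi// /restrict_measure arcD.
Qed.
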